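(* Let $n\ge2$ and let $Q=\{\mathbf{x}\in\mathbb{R}^n:(\mathbf{x}-\mathbf{c})^T[I-\epsilon^2\mathbf{v}\mathbf{v}^T](\mathbf{x}-\mathbf{c})=a^2-c^2\}$ be an ellipsoid in $\mathbb{R}^n$ with center $\mathbf{c}$, unit axis vector $\mathbf{v}$, parameters $0\le c<a$ and eccentricity $\epsilon=c/a<1$. Let $H\!P=\{\mathbf{x}\in\mathbb{R}^n:\mathbf{h}\cdot(\mathbf{x}-\mathbf{c})=\hat h\}$ be a hyperplane with $\|\mathbf{h}\|=1$ and $\hat h\in\mathbb{R}$, and let $\rho=\sqrt{1-(\mathbf{h}\cdot\mathbf{v})^2}$. If $\hat h^2<a^2(1-\epsilon^2\rho^2)$, then $Q\cap H\!P$ is an ellipsoid of dimension $n-1$.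
   Context: Norms are Euclidean. A subset of a hyperplane $A\subset\mathbb{R}^n$ is an ellipsoid of dimension $n-1$ if it equals $\{\mathbf{x}\in A:\|\mathbf{q}_2-\mathbf{x}\|+\|\mathbf{q}_1-\mathbf{x}\|=2\alpha\}$ for some $\mathbf{q}_1,\mathbf{q}_2\in A$ (possibly equal) and some $\alpha$ with $2\alpha>\|\mathbf{q}_1-\mathbf{q}_2\|$. *)

(* Defs.v *)
From mathcomp Require Import all_boot all_order all_algebra.
From mathcomp Require Import all_classical all_reals.

Set Implicit Arguments.
Unset Strict Implicit.
Unset Printing Implicit Defensive.

Import Order.TTheory GRing.Theory Num.Theory.
Local Open Scope classical_set_scope.
Local Open Scope ring_scope.

Definition dotv (R : realType) (n : nat) (u v : 'cV[R]_n) : R :=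
  \sum_(i < n) u i 0 * v i 0.

(* The norm that MathComp-Analysis puts on matrices is the sup norm, hence a
   separate definition of the Euclidean one. *)
Definition enorm (R : realType) (n : nat) (u : 'cV[R]_n) : R :=
  Num.sqrt (dotv u u).

(* The ellipsoid of revolution with center [ctr], unit axis vector [v], major
   semi-axis [a] and foci [ctr +/- c *: v]; [c / a] is its eccentricity. *)
Definition ellipsoid (R : realType) (n : nat) (ctr v : 'cV[R]_n) (a c : R) :
    set 'cV[R]_n :=
  [set x | ((x - ctr)^T *m (1%:M - (c / a) ^+ 2 *: (v *m v^T)) *m (x - ctr))
             0 0 = a ^+ 2 - c ^+ 2].

Definition hyperplane (R : realType) (n : nat) (ctr h : 'cV[R]_n) (d : R) :
    set 'cV[R]_n :=
  [set x | dotv h (x - ctr) = d].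

Definition is_hyperplane (R : realType) (n : nat) (A : set 'cV[R]_n) : Prop :=
  exists (h p : 'cV[R]_n) (d : R), h <> 0 /\ A = hyperplane p h d.

(* [E] is an ellipsoid of dimension n - 1 lying in the hyperplane [A]; the
   dimension is that of the ambient space [A], not of the surface [E]. *)
Definition is_ellipsoid_in (R : realType) (n : nat) (A E : set 'cV[R]_n) :
    Prop :=
  is_hyperplane A /\
  exists (q1 q2 : 'cV[R]_n) (alpha : R),
    [/\ A q1, A q2, enorm (q1 - q2) < 2 * alpha &
        E = [set x | A x /\ enorm (q2 - x) + enorm (q1 - x) = 2 * alpha]].

(* Main.v *)
Require Import Defs.
From mathcomp Require Import all_boot all_order all_algebra.
From mathcomp Require Import all_classical all_reals.
From mathcomp Require Import ring lra.
Import Order.TTheory GRing.Theory Num.Theory.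
Local Open Scope classical_set_scope.
Local Open Scope ring_scope.

(** Write [k = h . v], [w = v - k h] (so [w . w = rho^2] and [w] is orthogonal
    to [h]), [E = 1 - eps^2 rho^2] and [x = ctr + hhat h + mu w + t] with
    [mu = eps^2 k hhat / E].  The choice of [mu] cancels the terms linear in
    [t], and the equation of the section becomes
    [t . t - eps^2 (w . t)^2 = (1 - eps^2) (a^2 - hhat^2 / E)].
    This is the two-focus equation with foci [t = +/- eps alpha w] and
    [alpha^2 = (1 - eps^2) (a^2 - hhat^2 / E) / E], which is positive exactly
    under the assumption on [hhat]. *)

Section DotProduct.
Variables (R : realType) (n : nat).
Implicit Types (u v w p t : 'cV[R]_n) (k alpha : R).

Lemma dotvC u v : dotv u v = dotv v u.
Proof. by apply: eq_bigr => i _; rewrite mulrC. Qed.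

Lemma dotvDl u v w : dotv (u + v) w = dotv u w + dotv v w.
Proof. by rewrite -big_split; apply: eq_bigr => i _; rewrite mxE mulrDl. Qed.

Lemma dotvZl k u v : dotv (k *: u) v = k * dotv u v.
Proof. by rewrite mulr_sumr; apply: eq_bigr => i _; rewrite mxE mulrA. Qed.

Lemma dotvDr u v w : dotv w (u + v) = dotv w u + dotv w v.
Proof. by rewrite !(dotvC w) dotvDl. Qed.

Lemma dotvZr k u v : dotv v (k *: u) = k * dotv v u.
Proof. by rewrite !(dotvC v) dotvZl. Qed.

Lemma dotvNl u v : dotv (- u) v = - dotv u v.
Proof. by rewrite -scaleN1r dotvZl mulN1r. Qed.

Lemma dotvNr u v : dotv v (- u) = - dotv v u.
Proof. by rewrite !(dotvC v) dotvNl. Qed.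

Definition dotvE := (dotvDl, dotvDr, dotvNl, dotvNr, dotvZl, dotvZr).

Lemma dotvv_ge0 u : 0 <= dotv u u.
Proof. by apply: sumr_ge0 => i _; rewrite -expr2 sqr_ge0. Qed.

Lemma enorm_sqr u : enorm u ^+ 2 = dotv u u.
Proof. by rewrite sqr_sqrtr ?dotvv_ge0. Qed.

Lemma dotvv_eq0 u v : dotv u u = 0 -> dotv u v = 0.
Proof.
move=> /eqP; rewrite psumr_eq0 => [/allP u0|i _]; last by rewrite -expr2 sqr_ge0.
apply: big1 => i _; have := u0 i (mem_index_enum i).
by rewrite mulf_eq0 orbb => /eqP ->; rewrite mul0r.
Qed.

(** The squared length of [(u . u) v - (u . v) u] is [u . u] times the gap between the two sides, so
    dividing by [u . u] suffices unless it is zero; then [u] is orthogonal to everything. *)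
Lemma dotv_CauchySchwarz u v : dotv u v ^+ 2 <= dotv u u * dotv v v.
Proof.
have [u0|u0] := eqVneq (dotv u u) 0.
  by rewrite (dotvv_eq0 u v u0) u0 mul0r expr0n.
have ugt0 : 0 < dotv u u by rewrite lt_def u0 dotvv_ge0.
have := dotvv_ge0 (dotv u u *: v - dotv u v *: u).
rewrite !dotvE (dotvC v u).
set P := dotv u u; set T := dotv v v; set s := dotv u v => H.
rewrite -subr_ge0 -(pmulr_rge0 _ ugt0) -/P.
by apply: le_trans H _; rewrite le_eqVlt; apply/orP; left; apply/eqP; ring.
Qed.

(** Let [X] and [Y] be the two distances. Since [X^2 - Y^2 = - 4 (p . t)], the sum [2 alpha] forces
    [alpha X = alpha^2 - p . t], and squaring gives the conic. Conversely, the conic makes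
    [alpha^2 - p . t] and [alpha^2 + p . t] equal to [alpha X] and [alpha Y] up to sign; the signs
    follow from [|p . t| <= alpha^2]. *)
Lemma enorm_sum_foci p t alpha : 0 < alpha -> dotv p p < alpha ^+ 2 ->
  enorm (p - t) + enorm (- p - t) = 2 * alpha <->
  alpha ^+ 2 * dotv t t - dotv p t ^+ 2 = alpha ^+ 2 * (alpha ^+ 2 - dotv p p).
Proof.
move=> al0 pal.
have := dotv_CauchySchwarz p t.
have := enorm_sqr (p - t); have := enorm_sqr (- p - t).
have : 0 <= enorm (p - t) by exact: sqrtr_ge0.
have : 0 <= enorm (- p - t) by exact: sqrtr_ge0.
rewrite !dotvE (dotvC t p) => Y0 X0.
move: (enorm (p - t)) (enorm (- p - t)) X0 Y0 => X Y X0 Y0.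
move: (dotv p p) (dotv t t) (dotv p t) pal => P T s pal Y2 X2 cs.
split=> [XY | conic].
  have aX : alpha * X = alpha ^+ 2 - s by nra.
  have : (alpha * X) ^+ 2 = (alpha ^+ 2 - s) ^+ 2 by rewrite aX.
  by rewrite exprMn X2; nra.
(* Bounding [s^2] by [P T] turns the conic into [T (alpha^2 - P) <= alpha^2 (alpha^2 - P)].
   Afterwards [s^2 <= P T <= alpha^4]. *)
have Tal : T <= alpha ^+ 2.
  have P0 : 0 < alpha ^+ 2 - P by lra.
  by rewrite -(ler_pM2r P0); lra.
have sal : `|s| <= alpha ^+ 2.
  rewrite -ler_sqr ?nnegrE ?normr_ge0 ?sqr_ge0 // real_normK ?num_real //.
  have T0 : 0 <= alpha ^+ 2 by exact: sqr_ge0.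
  by nra.
have /andP[sl su] : - alpha ^+ 2 <= s <= alpha ^+ 2 by rewrite -ler_norml.
have aX : alpha * X = alpha ^+ 2 - s.
  apply/eqP; rewrite -(eqrXn2 (n := 2)) //; [|by rewrite mulr_ge0 // ltW|lra].
  by apply/eqP; rewrite exprMn X2; lra.
have aY : alpha * Y = alpha ^+ 2 + s.
  apply/eqP; rewrite -(eqrXn2 (n := 2)) //; [|by rewrite mulr_ge0 // ltW|lra].
  by apply/eqP; rewrite exprMn Y2; lra.
by apply: (mulfI (lt0r_neq0 al0)); rewrite mulrDr aX aY; ring.
Qed.

Lemma ellipsoid_dotv (ctr v x : 'cV[R]_n) (a c : R) :
  ellipsoid ctr v a c x <->
  dotv (x - ctr) (x - ctr) - (c / a) ^+ 2 * dotv v (x - ctr) ^+ 2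
    = a ^+ 2 - c ^+ 2.
Proof.
rewrite /ellipsoid /=; move: (x - ctr) => y.
have dotE (p q : 'cV[R]_n) : (p^T *m q) 0 0 = dotv p q.
  by rewrite mxE; apply: eq_bigr => i _; rewrite mxE.
suff -> : (y^T *m (1%:M - (c / a) ^+ 2 *: (v *m v^T)) *m y) 0 0 =
    dotv y y - (c / a) ^+ 2 * dotv v y ^+ 2 by [].
(* The rank-one term regroups as [(y^T v) (v^T y)], a product of 1 x 1 matrices, whose entries
   simply multiply. *)
have entryB (A B : 'M[R]_1) : (A - B) 0 0 = A 0 0 - B 0 0 by rewrite !mxE.
have entryZ k (A : 'M[R]_1) : (k *: A) 0 0 = k * A 0 0 by rewrite mxE.
have entryM (A B : 'M[R]_1) : (A *m B) 0 0 = A 0 0 * B 0 0.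
  by rewrite mxE big_ord1.
rewrite mulmxBr mulmx1 mulmxBl -scalemxAr -scalemxAl (mulmxA y^T) -(mulmxA (y^T *m v)).
by rewrite entryB entryZ entryM !dotE (dotvC y v) expr2.
Qed.

End DotProduct.

Theorem mainTheorem4 (R : realType) (n : nat) (ctr v h : 'cV[R]_n)
    (a c eps hhat rho : R)
    (hn : (2 <= n)%N)
    (hv : enorm v = 1)
    (hc : 0 <= c) (hca : c < a)
    (heps : eps = c / a)
    (hh : enorm h = 1)
    (hrho : rho = Num.sqrt (1 - dotv h v ^+ 2))
    (hlt : hhat ^+ 2 < a ^+ 2 * (1 - eps ^+ 2 * rho ^+ 2)) :
  is_ellipsoid_in (hyperplane ctr h hhat)
    (ellipsoid ctr v a c `&` hyperplane ctr h hhat).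
Proof.
have a0 : 0 < a by exact: le_lt_trans hca.
have vv : dotv v v = 1 by rewrite -enorm_sqr hv expr1n.
have hh1 : dotv h h = 1 by rewrite -enorm_sqr hh expr1n.
have k1 : dotv h v ^+ 2 <= 1.
  by have := dotv_CauchySchwarz _ _ h v; rewrite vv hh1 mulr1.
have rho2 : rho ^+ 2 = 1 - dotv h v ^+ 2.
  by rewrite hrho sqr_sqrtr // subr_ge0.
have eps0 : 0 <= eps by rewrite heps divr_ge0 // ltW.
have eps1 : eps < 1 by rewrite heps ltr_pdivrMr // mul1r.
have eps21 : eps ^+ 2 < 1 by rewrite expr_lt1.
have cE : c = eps * a by rewrite heps divfK ?gt_eqF.
split.
  exists h, ctr, hhat; split=> // h0.
  by move: hh1; rewrite h0 -(scale0r 0) dotvZl mul0r => /eqP; rewrite eq_sym oner_eq0.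
set k := dotv h v in k1 rho2.
pose w := v - k *: h.
have hw : dotv h w = 0 by rewrite !dotvE hh1 -/k mulr1 subrr.
have ww : dotv w w = rho ^+ 2.
  by rewrite !dotvE (dotvC _ _ v h) hh1 vv -/k rho2; ring.
(* [v - w] is a multiple of [h], so [v] and [w] have the same inner product with anything orthogonal
   to [h]: here [w] itself, later [t]. *)
have vw : dotv v w = rho ^+ 2.
  by rewrite !dotvE (dotvC _ _ v h) vv -/k rho2; ring.
have vw_perp u : dotv h u = 0 -> dotv v u = dotv w u.
  by move=> hu; rewrite dotvDl dotvNl dotvZl hu; ring.
clearbody w.
pose E := 1 - eps ^+ 2 * rho ^+ 2.
have rho21 : rho ^+ 2 <= 1 by rewrite rho2 lerBlDr lerDl sqr_ge0.
have E0 : 0 < E.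
  rewrite subr_gt0; apply: le_lt_trans eps21.
  by rewrite ler_piMr ?sqr_ge0.
have En0 : E != 0 by rewrite gt_eqF.
(* The coefficient of [w . t] in the section equation is [2 (mu E - eps^2 k hhat)]. *)
pose mu := eps ^+ 2 * k * hhat / E.
pose B := (1 - eps ^+ 2) * (a ^+ 2 - hhat ^+ 2 / E).
have B0 : 0 < B.
  by rewrite mulr_gt0 ?subr_gt0 // ltr_pdivrMr.
(* For [p = eps alpha w], the conic of [enorm_sum_foci] divided by [alpha^2] reads
   [t . t - eps^2 (w . t)^2 = alpha^2 E]; its right side has to be [B]. *)
pose alpha := Num.sqrt (B / E).
have al0 : 0 < alpha by rewrite sqrtr_gt0 divr_gt0.
have al2 : alpha ^+ 2 = B / E by rewrite sqr_sqrtr // ltW // divr_gt0.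
pose p := (eps * alpha) *: w.
pose m := hhat *: h + mu *: w.
have pp : dotv p p = alpha ^+ 2 * (eps ^+ 2 * rho ^+ 2).
  by rewrite !dotvE ww; ring.
(* The gap is [alpha^2 E]; its positivity also puts the foci less than [2 alpha] apart. *)
have pal : dotv p p < alpha ^+ 2.
  by rewrite pp gtr_pMr ?exprn_gt0 // -subr_gt0.
(* The section is centered at [ctr + m]. Both foci lie in the hyperplane because [h . m = hhat] and
   [h . p = 0]. *)
exists (ctr + m - p), (ctr + m + p), alpha; split.
- rewrite /hyperplane /=.
  have -> : ctr + m - p - ctr = m - p.
    by apply/matrixP => i j; rewrite !mxE; ring.
  by rewrite !dotvE hw hh1; ring.
- rewrite /hyperplane /=.
  have -> : ctr + m + p - ctr = m + p.
    by apply/matrixP => i j; rewrite !mxE; ring.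
  by rewrite !dotvE hw hh1; ring.
- have -> : ctr + m - p - (ctr + m + p) = (- 2) *: p.
    by apply/matrixP => i j; rewrite !mxE; ring.
  rewrite -ltr_sqr ?nnegrE ?sqrtr_ge0 ?mulr_ge0 ?(ltW al0) //.
  by rewrite enorm_sqr dotvZl dotvZr; lra.
apply/seteqP.
suff key x : hyperplane ctr h hhat x ->
    ellipsoid ctr v a c x <->
    enorm (ctr + m + p - x) + enorm (ctr + m - p - x) = 2 * alpha.
  split=> x /= [].
    by move=> Qx Hx; split=> //; apply/key.
  by move=> Hx Fx; split=> //; apply/key.
rewrite /hyperplane /= => Hx.
pose t := x - ctr - m.
have xt : x - ctr = m + t by rewrite [m + t]addrC subrK.
have -> : ctr + m + p - x = p - t.
  by apply/matrixP => i j; rewrite !mxE; ring.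
have -> : ctr + m - p - x = - p - t.
  by apply/matrixP => i j; rewrite !mxE; ring.
have ht : dotv h t = 0.
  by rewrite /t dotvDr Hx !dotvE hw hh1; ring.
have vt : dotv v t = dotv w t by exact: vw_perp.
clearbody t.
apply: iff_trans (ellipsoid_dotv _ _ _ _ _ _ _) _.
apply: iff_trans (iff_sym (enorm_sum_foci _ _ _ _ _ al0 pal)).
have -> : dotv v (x - ctr) = hhat * k + mu * rho ^+ 2 + dotv w t.
  by rewrite xt /m 2!dotvDr !dotvZr vw vt (dotvC _ _ v h).
have -> : dotv (x - ctr) (x - ctr) =
    hhat ^+ 2 + mu ^+ 2 * rho ^+ 2 + 2 * mu * dotv w t + dotv t t.
  rewrite xt /m !dotvDl !dotvDr !dotvZl !dotvZr (dotvC _ _ w h) (dotvC _ _ t h) (dotvC _ _ t w).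
  by rewrite hw ht hh1 ww; ring.
rewrite -heps pp /p dotvZl cE.
move: (dotv w t) (dotv t t) => s T.
have -> : alpha ^+ 2 * T - (eps * alpha * s) ^+ 2 =
    alpha ^+ 2 * (T - eps ^+ 2 * s ^+ 2) by ring.
have -> : alpha ^+ 2 * (alpha ^+ 2 - alpha ^+ 2 * (eps ^+ 2 * rho ^+ 2)) =
    alpha ^+ 2 * B.
  by rewrite -[B](divfK En0) -al2 /E; ring.
(* The two equations have the same difference of sides, modulo [k^2 = 1 - rho^2]; hence they are
   equivalent once the factor [alpha^2] is cancelled. *)
have eqn : hhat ^+ 2 + mu ^+ 2 * rho ^+ 2 + 2 * mu * s + T
    - eps ^+ 2 * (hhat * k + mu * rho ^+ 2 + s) ^+ 2
    - (a ^+ 2 - (eps * a) ^+ 2) = T - eps ^+ 2 * s ^+ 2 - B.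
  have r2 : k ^+ 2 = 1 - rho ^+ 2 by rewrite rho2; ring.
  by rewrite /B /mu /E; field: r2; rewrite exprMn.
split=> [Hq|/(mulfI (lt0r_neq0 (exprn_gt0 2 al0))) Hq].
  by congr (_ * _); apply/eqP; rewrite -subr_eq0 -eqn Hq subrr.
by apply/eqP; rewrite -subr_eq0 eqn Hq subrr.
Qed.
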